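(* Let $S$ be an infinite discrete set with Stone--Čech compactification $\beta S$, and let $X$ be a (real or complex) Banach space. Let $\Phi\in C(\beta S,X)_1^*$ be a w$^*$-w PC. If there exists a countable set $A=\{x_i:i\in\mathbb{N}\}\subseteq X_1$ such that each element of $\mathrm{range}(\Phi)$ attains its norm on $A$ and $\overline{A}\subseteq X_1$ is norm compact, then $\Phi$ attains its norm on $S(C(\beta S,X))$.
   Context: $X_1$ is the closed unit ball of $X$; for a Banach space $Y$, $S(Y)$ denotes its unit sphere and $Y_1^*$ the closed unit ball of $Y^*$. A point $y^*\in Y_1^*$ is called a w$^*$-w PC (weak$^*$-to-weak point of continuity) if the identity map $(Y_1^*,\text{weak}^* )\to(Y_1^*,\text{weak})$ is continuous at $y^*$, where weak$^*$ is $\sigma(Y^*,Y)$ and weak is $\sigma(Y^*,Y^{**})$. For a compact Hausdorff space $\Omega$, $C(\Omega,X)$ is the Banach space of continuous functions $\Omega\to X$ with the supremum norm; its dual is identified with $M(\Omega,X^* )$, the space of $X^*$-valued regular Borel measures of bounded variation with the total variation norm, so that the functional $f\mapsto x^*(f(\omega))$ corresponds to the measure $\delta_\omega\otimes x^*$, $B\mapsto\delta_\omega(B)x^*$. For $\Phi\in M(\Omega,X^* )$, $\mathrm{range}(\Phi)=\{\Phi(B)\in X^*: B\text{ is a Borel subset of }\Omega\}$. A functional $y^*\in Y^*$ attains its norm on a set $D\subseteq Y_1$ if there is $d\in D$ with $y^*(d)=\|y^*\|$.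
   Formalization: The Banach space X is assumed nonzero; for X = {0} the unit sphere S(C(βS,X)) is empty while Φ = 0 and A = {0} satisfy every hypothesis, so the claim fails there. *)

(* Defs.v *)
From HB Require Import structures.
From mathcomp Require Import all_boot all_order all_algebra.
From mathcomp Require Import all_classical all_reals all_analysis.
From mathcomp Require Import complex.

Set Implicit Arguments.
Unset Strict Implicit.
Unset Printing Implicit Defensive.

Import Order.TTheory GRing.Theory Num.Theory.
Import numFieldNormedType.Exports.

Local Open Scope classical_set_scope.
Local Open Scope ring_scope.

Variant scalar_kind := RealScalars | ComplexScalars.

Definition scalar_field (R : realType) (k : scalar_kind) : numFieldType :=
  match k with
  | RealScalars => R
  | ComplexScalars => (R[i])%C
  end.

(* Norms of K-normed modules are K-valued in MathComp; for complex K the order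
   on K is partial, but bounded nonempty sets of norms still have a least upper
   bound, so that [supremum] can be used for both kinds of scalars. *)
Lemma scalar_supremums (R : realType) (k : scalar_kind)
    (A : set (scalar_field R k)) :
  A !=set0 -> (forall a, A a -> 0 <= a) -> has_ubound A -> supremums A !=set0.
Proof.
case: k A => /= A [a Aa] A0 [M AM].
  have hA : has_sup A by split; [exists a | exists M].
  exists (sup A); split; first exact: sup_upper_bound.
  by move=> b /(ge_sup (ex_intro _ a Aa)).
have Re_le x y : 0 <= x -> x <= y -> complex.Re x <= complex.Re y.
  by move=> _; rewrite lecE => /andP[].
have ImA x : A x -> complex.Im x = 0.
  by move=> /A0; rewrite lecE /= => /andP[/eqP].
pose B := [set complex.Re x | x in A].
have hB : has_sup B.
  split; first by exists (complex.Re a), a.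
  by exists (complex.Re M) => _ [x Ax <-]; apply: Re_le; [exact: A0|exact: AM].
exists ((sup B)%:C)%C; split.
  move=> x Ax; rewrite lecE /= (ImA _ Ax) eqxx /=.
  by apply: sup_upper_bound => //; exists x.
move=> b Ab; rewrite lecE /=; have := Ab _ Aa.
rewrite lecE (ImA _ Aa) => /andP[-> _] /=.
apply: ge_sup; first by exists (complex.Re a), a.
by move=> _ [x Ax <-]; apply: Re_le; [exact: A0|exact: Ab].
Qed.

Section SupNorm.
Context (R : realType) (k : scalar_kind).
Local Notation K := (scalar_field R k).
Context (I : Type) (V : normedModType K).
Implicit Types (D : set I) (F G : I -> V).

Definition sup_norm D F : K := supremum 0 [set `|F i| | i in D].

Lemma sup_norm_ge D F (M : K) : (forall i, D i -> `|F i| <= M) ->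
  forall i, D i -> `|F i| <= sup_norm D F.
Proof.
move=> FM i Di; rewrite /sup_norm /supremum.
have An0 : [set `|F i| | i in D] !=set0 by exists `|F i|, i.
case: ifPn => [/eqP A0|_]; first by move: An0; rewrite A0 => -[].
have [] := scalar_supremums An0; first by move=> _ [j _ <-].
  by exists M => _ [j Dj <-]; exact: FM.
move=> s hs; case: xgetP => [y _ [uy _]|/(_ s)//].
by apply: uy; exists i.
Qed.

Lemma sup_norm_le D F (M : K) : 0 <= M -> (forall i, D i -> `|F i| <= M) ->
  sup_norm D F <= M.
Proof.
move=> M0 FM; rewrite /sup_norm /supremum; case: ifPn => // _.
case: xgetP => // y _ [_]; apply.
by move=> _ [j Dj <-]; exact: FM.
Qed.

Lemma sup_norm_ge0 D F : 0 <= sup_norm D F.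
Proof.
rewrite /sup_norm /supremum; case: ifPn => // /set0P[_ [i Di _]].
case: xgetP => // y _ [uy _]; apply: (le_trans (normr_ge0 (F i))).
by apply: uy; exists i.
Qed.

Lemma sup_normD D F G (M N : K) :
  (forall i, D i -> `|F i| <= M) -> (forall i, D i -> `|G i| <= N) ->
  sup_norm D (F + G) <= sup_norm D F + sup_norm D G.
Proof.
move=> FM GN; apply: sup_norm_le; first by rewrite addr_ge0 ?sup_norm_ge0.
move=> i Di; apply: (le_trans (ler_normD _ _)).
by apply: lerD; [exact: (sup_norm_ge FM)|exact: (sup_norm_ge GN)].
Qed.

Lemma sup_norm_scale_le D F (M a : K) : (forall i, D i -> `|F i| <= M) ->
  sup_norm D (a *: F) <= `|a| * sup_norm D F.
Proof.
move=> FM; apply: sup_norm_le; first by rewrite mulr_ge0 ?sup_norm_ge0.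
by move=> i Di; rewrite normrZ ler_wpM2l //; exact: (sup_norm_ge FM).
Qed.

Lemma sup_normZ D F (M a : K) : (forall i, D i -> `|F i| <= M) ->
  sup_norm D (a *: F) = `|a| * sup_norm D F.
Proof.
move=> FM; apply/eqP; rewrite eq_le (sup_norm_scale_le a FM) /=.
have [->|a0] := eqVneq a 0; first by rewrite normr0 mul0r sup_norm_ge0.
have aFM i : D i -> `|(a *: F) i| <= `|a| * M.
  by move=> Di; rewrite normrZ ler_wpM2l //; exact: FM.
have := sup_norm_scale_le a^-1 aFM.
rewrite scalerA mulVf // scale1r normfV => h.
by rewrite -ler_pdivlMl ?normr_gt0.
Qed.

End SupNorm.

HB.mixin Record isCompactHausdorff T & Topological T := {
  compact_setT : compact [set: T];
  hausdorff_setT : hausdorff_space T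
}.

#[short(type="compactHausdorffType")]
HB.structure Definition CompactHausdorff :=
  {T of Topological T & isCompactHausdorff T}.

Definition stone_cech (S : topologicalType) (bS : compactHausdorffType)
    (i : S -> bS) : Prop :=
  continuous i /\
  forall (T : compactHausdorffType) (f : S -> T), continuous f ->
    exists! g : bS -> T, continuous g /\ g \o i = f.

Section ContinuousFunctions.
Context (R : realType) (k : scalar_kind).
Local Notation K := (scalar_field R k).
Context (T : compactHausdorffType) (X : normedModType K).

Definition contfun_pred : {pred T -> X} := fun f => `[< continuous f >].

Record contfun := ContFun {
  contfun_val :> T -> X;
  contfunP : contfun_val \in contfun_pred
}.

HB.instance Definition _ := [isSub for contfun_val].
HB.instance Definition _ := [Choice of contfun by <:].

Lemma contfun_continuous (f : contfun) : continuous f.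
Proof. exact: (asboolW (contfunP f)). Qed.

Fact contfun_submod_closed : submod_closed contfun_pred.
Proof.
split; first by apply/asboolP => x; exact: cvg_cst.
move=> a f g /asboolP cf /asboolP cg; apply/asboolP => x.
by apply: cvgD; [apply: cvgZl_tmp; exact: cf|exact: cg].
Qed.

HB.instance Definition _ :=
  GRing.isSubmodClosed.Build K (T -> X) contfun_pred contfun_submod_closed.
HB.instance Definition _ := [SubChoice_isSubLmodule of contfun by <:].

Lemma contfun_bounded (f : contfun) :
  exists M : K, forall x, [set: T] x -> `|f x| <= M.
Proof.
have /compact_near_coveringP cT := @compact_setT T.
have fF : \forall M \near (+oo : set_system K), [set: T] `<=` [set x | `|f x| <= M].
  apply: cT => x _.
  have fx1 : \forall y \near x, `|f y| <= `|f x| + 1.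
    near=> y; rewrite -lerBlDl (le_trans (lerB_dist _ _)) // distrC.
    near: y; apply: (@cvgr_dist_le _ _ _ (nbhs x) _ f (f x)) => //.
    exact: contfun_continuous.
  have M1 : \forall M \near (+oo : set_system K), `|f x| + 1 <= M.
    by apply: nbhs_pinfty_ge; rewrite realD ?normr_real ?real1.
  near=> y M => /=; apply: (@le_trans _ _ (`|f x| + 1)); first by near: y.
  by near: M.
have [M fM] := filter_ex fF.
by exists M => x _; exact: fM.
Unshelve. all: by end_near. Qed.

Definition contfun_norm (f : contfun) : K := sup_norm [set: T] f.

Fact contfun_normD f g :
  contfun_norm (f + g) <= contfun_norm f + contfun_norm g.
Proof.
have [M fM] := contfun_bounded f; have [N gN] := contfun_bounded g.
exact: (sup_normD fM gN).
Qed.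

Fact contfun_normZ a f : contfun_norm (a *: f) = `|a| * contfun_norm f.
Proof. by have [M fM] := contfun_bounded f; exact: (sup_normZ a fM). Qed.

Fact contfun_norm0_eq0 f : contfun_norm f = 0 -> f = 0.
Proof.
move=> f0; apply/val_inj/funext => x; apply/eqP; rewrite -normr_le0 -f0.
by have [M fM] := contfun_bounded f; exact: (sup_norm_ge fM).
Qed.

HB.instance Definition _ := Lmodule_isNormed.Build K contfun
  contfun_normD contfun_normZ contfun_norm0_eq0.

End ContinuousFunctions.

Section Dual.
Context (R : realType) (k : scalar_kind).
Local Notation K := (scalar_field R k).
Context (Y : normedModType K).

Definition dual_pred : {pred Y -> K^o} :=
  fun f => `[< linear f /\ continuous f >].

Record dual := Dual {
  dual_val :> Y -> K^o;
  dualP : dual_val \in dual_pred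
}.

HB.instance Definition _ := [isSub for dual_val].
HB.instance Definition _ := [Choice of dual by <:].

Lemma dual_linear (f : dual) : linear f.
Proof. by have [] := asboolW (dualP f). Qed.

Lemma dual_continuous (f : dual) : continuous f.
Proof. by have [] := asboolW (dualP f). Qed.

HB.instance Definition _ (f : dual) :=
  GRing.isLinear.Build K Y K^o _ f (dual_linear f).

Fact dual_submod_closed : submod_closed dual_pred.
Proof.
split.
  apply/asboolP; split; last by move=> x; exact: cvg_cst.
  by move=> a x y; rewrite scaler0 addr0.
move=> a f g /asboolP[lf cf] /asboolP[lg cg]; apply/asboolP; split.
  move=> b x y; change (a *: f (b *: x + y) + g (b *: x + y) =
    b *: (a *: f x + g x) + (a *: f y + g y) :> K^o).
  by rewrite lf lg !scalerDr !scalerA [b * a]mulrC addrACA.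
move=> x.
by apply: cvgD; [apply: cvgZl_tmp; exact: cf|exact: cg].
Qed.

HB.instance Definition _ :=
  GRing.isSubmodClosed.Build K (Y -> K^o) dual_pred dual_submod_closed.
HB.instance Definition _ := [SubChoice_isSubLmodule of dual by <:].

Definition unit_ball : set Y := [set y | `|y| <= 1].
Definition unit_sphere : set Y := [set y | `|y| = 1].

Lemma dual_bounded (f : dual) :
  exists M : K, forall y, unit_ball y -> `|f y| <= M.
Proof.
have /linear_bounded_continuous/bounded_funP/(_ 1)[M fM] := @dual_continuous f.
by exists M.
Qed.

Definition dual_norm (f : dual) : K := sup_norm unit_ball f.

Fact dual_normD f g : dual_norm (f + g) <= dual_norm f + dual_norm g.
Proof.
have [M fM] := dual_bounded f; have [N gN] := dual_bounded g.
exact: (sup_normD fM gN).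
Qed.

Fact dual_normZ a f : dual_norm (a *: f) = `|a| * dual_norm f.
Proof. by have [M fM] := dual_bounded f; exact: (sup_normZ a fM). Qed.

Fact dual_norm0_eq0 f : dual_norm f = 0 -> f = 0.
Proof.
move=> f0; apply/val_inj/funext => y /=.
have [->|y0] := eqVneq y 0; first by rewrite linear0.
have ny0 : `|y| != 0 by rewrite normr_eq0.
have By : unit_ball (`|y|^-1 *: y).
  by rewrite /unit_ball /= normrZ normfV normr_id mulVf.
have [M fM] := dual_bounded f.
have := sup_norm_ge fM By; rewrite -/(dual_norm f) f0 normr_le0 linearZ.
by rewrite scaler_eq0 invr_eq0 (negbTE ny0) /= => /eqP.
Qed.

HB.instance Definition _ := Lmodule_isNormed.Build K dual
  dual_normD dual_normZ dual_norm0_eq0.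

Definition attains_norm (f : dual) (D : set Y) : Prop :=
  exists2 d, D d & f d = `|f|.

End Dual.

Arguments unit_ball {R k} Y.
Arguments unit_sphere {R k} Y.

Section WeakTopologies.
Context (R : realType) (k : scalar_kind).
Local Notation K := (scalar_field R k).
Context (Y : normedModType K).

Definition weak : topologicalType :=
  initial_topology ((fun y => fun f : dual Y => f y) :
    Y -> {ptws dual Y -> K^o}).

Definition weak_star : topologicalType :=
  initial_topology ((fun f => fun y : Y => f y) :
    dual Y -> {ptws Y -> K^o}).

End WeakTopologies.

Definition weak_star_weak_PC (R : realType) (k : scalar_kind)
    (Y : normedModType (scalar_field R k)) (phi : dual Y) : Prop :=
  let B : set (weak_star Y) := unit_ball (dual Y) in
  B phi /\
  {for (phi : subspace B),
    continuous ((fun f => f) : subspace B -> weak (dual Y))}.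

Section VectorMeasures.
Context (R : realType) (k : scalar_kind).
Local Notation K := (scalar_field R k).
Context (T : topologicalType).

Definition borel : set (set T) := <<s open >>.

Definition borel_partition (n : nat) (P : 'I_n -> set T) (B : set T) : Prop :=
  [/\ forall j, borel (P j), trivIset [set: 'I_n] P & \bigcup_j P j = B].

Section Measure.
Context (E : normedModType K) (mu : set T -> E).

Definition countably_additive : Prop :=
  forall F : (set T)^nat, (forall n, borel (F n)) -> trivIset [set: nat] F ->
    series (mu \o F) @ \oo --> mu (\bigcup_n F n).

Definition variation_sums (B : set T) : set K :=
  [set s | exists n (P : 'I_n -> set T),
    borel_partition P B /\ s = \sum_(j < n) `|mu (P j)|].

Definition bounded_variation : Prop := has_ubound (variation_sums [set: T]).

(* Meaningful for Borel B and mu of bounded variation. *)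
Definition variation (B : set T) : K := supremum 0 (variation_sums B).

Definition regular_measure : Prop :=
  forall B, borel B -> forall e : K, 0 < e ->
    exists C U, [/\ compact C, open U, C `<=` B, B `<=` U &
      variation (U `\` C) < e].

Definition regular_borel_measure : Prop :=
  [/\ countably_additive, bounded_variation & regular_measure].

End Measure.

Section Integral.
Context (X : normedModType K) (mu : set T -> dual X).

(* [l] is the integral of f : T -> X against mu: the limit of the integrals
   \sum_j mu (P j) (x j) of the Borel simple functions \sum_j 1_(P j) x j as
   these converge uniformly to f. *)
Definition is_integral (f : T -> X) (l : K) : Prop :=
  forall e : K, 0 < e -> exists2 d : K, 0 < d &
    forall n (P : 'I_n -> set T) (x : 'I_n -> X),
      borel_partition P [set: T] ->
      (forall j t, P j t -> `|f t - x j| <= d) ->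
      `|l - \sum_(j < n) (mu (P j) (x j) : K)| <= e.

End Integral.

End VectorMeasures.

Arguments borel T : clear implicits.

(* The identification of C(T, X)^* with M(T, X^* ): the functional Phi is
   integration against the measure mu. *)
Definition represents (R : realType) (k : scalar_kind)
    (T : compactHausdorffType) (X : normedModType (scalar_field R k))
    (mu : set T -> dual X) (Phi : dual (contfun T X)) : Prop :=
  regular_borel_measure mu /\
  forall f : contfun T X, is_integral mu f (Phi f).

(* Main.v *)
From HB Require Import structures.
Require Import Defs.
From mathcomp Require Import all_boot all_order all_algebra.
From mathcomp Require Import all_classical all_reals all_analysis.
From mathcomp Require Import complex finmap.
From mathcomp Require Import summability.

Import Order.TTheory GRing.Theory Num.Theory.
Import numFieldNormedType.Exports.

Local Open Scope classical_set_scope.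
Local Open Scope ring_scope.

Set Implicit Arguments.
Unset Strict Implicit.
Unset Printing Implicit Defensive.

(** Write [Y] for the space [contfun bS X] and, for [s : S] and [g : Y], write
    [atom i s g] for the function equal to [g] at the point [i s] and to 0
    elsewhere; it is continuous because the points of [S] are isolated in its
    Stone-Cech compactification.

    The theorem follows from one fact: a weak*-to-weak point of continuity
    [Phi] is concentrated on [S], that is, [Phi g] is the unordered sum of the
    numbers [Phi (atom i s g)] for every [g]
    ([weak_star_weak_PC_sum_atoms]).  To see it, fix [g]. For any functional
    [Psi] the family [Psi (atom i s g)] is absolutely summable with bound
    [|Psi| |g|] ([atoms_abs_sum_le]), so that
      [F Psi = Psi g - \sum_s Psi (atom i s g)]
    is an element of the bidual of [Y] ([atomic_defect]); it has to be shown
    that [F] vanishes at [Phi]. If [sigma : S -> S] has finite range, and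
    [h : bS -> bS] extends [sigma], then [u sigma : g |-> Phi (g \o h)] has
    norm at most [|Phi|] and only depends on finitely many values
    of [g], whence [F (u sigma) = 0]. When [sigma] tends to the identity in the
    sense of [uniformly_near_id], [g \o h] tends to [g] in norm, so that
    [u sigma] tends weak* to [Phi] inside the dual ball. At a point of
    continuity it also tends weakly, and [F Phi = lim F (u sigma) = 0].

    Now let [v s] be a point of [range x] at which the functional
    [mu [set i s]], a member of the range of the measure, attains its norm.
    As the closure of [range x] is compact, [v] extends to a continuous function
    [f] on [bS], and [|f| <= 1]. For [|g| <= 1],
      [|Phi (atom i s g)| = |mu [set i s] (g (i s))| <= |mu [set i s]|
        = Phi (atom i s f)],
    and summing over [s] gives [|Phi g| <= |Phi f|] ([norming_of_atoms]).
    Hence [|Phi| = |Phi f|], and multiplying [f] by a scalar of modulus one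
    turns this into [Phi f = |Phi|]. *)

(** * Extension of functions on a discrete set to its compactification *)

HB.instance Definition _ :=
  isCompactHausdorff.Build bool bool_compact discrete_hausdorff.

Section CompactSubset.
Context (Z : topologicalType) (C : set Z).
Hypotheses (hZ : hausdorff_space Z) (cC : compact C).

Lemma set_type_hausdorff : hausdorff_space (set_type C).
Proof.
move=> p q pq; apply: val_inj; apply: hZ => A B Ap Bq.
have [r []] := pq (set_val @^-1` A) (set_val @^-1` B)
  (@initial_continuous _ _ set_val p A Ap)
  (@initial_continuous _ _ set_val q B Bq).
by exists (set_val r).
Qed.

Lemma set_type_compact : compact [set: set_type C].
Proof.
move=> F FF _.
have FC : F (set_val @^-1` C) by apply: (@filterE _ F) => x; exact: set_valP.
have [z [Cz Fz]] := cC (fmap_proper_filter set_val FF) FC.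
exists (SigSub (mem_set Cz)); split => //.
move=> A B FA [_ [[U oU <-] /= Uz] UB].
have [||_ [[x Ax <-] Ux]] := Fz (set_val @` A) U.
- by rewrite /fmap /=; apply: (@filterS _ F FF _ _ _ FA) => x Ax; exists x.
- by apply: open_nbhs_nbhs.
by exists x; split => //; apply: UB.
Qed.

End CompactSubset.

Lemma discrete_continuous (S : discreteTopologicalType) (T : topologicalType)
  (f : S -> T) : continuous f.
Proof. by apply/continuousP => A _; exact: discrete_open. Qed.

Section StoneCech.
Context (S : discreteTopologicalType) (bS : compactHausdorffType) (i : S -> bS).
Hypothesis sc : stone_cech i.

(** A compact subset of a Hausdorff space is itself a compact Hausdorff space,
    to which the universal property applies. *)
Lemma stone_cech_extend_compact (Z : topologicalType) (C : set Z) (f : S -> Z) :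
  hausdorff_space Z -> compact C -> (forall s, C (f s)) ->
  exists g : bS -> Z, [/\ continuous g, g \o i = f & forall t, C (g t)].
Proof.
move=> hZ cC Cf.
pose T : compactHausdorffType := HB.pack (set_type C)
  (isCompactHausdorff.Build (set_type C) (set_type_compact cC)
     (set_type_hausdorff hZ)).
pose f' s : T := SigSub (mem_set (Cf s)).
have [g [[cg gi] _]] := sc.2 T f' (@discrete_continuous _ _ _).
exists (set_val \o g); split.
- by move=> t; apply: continuous_comp; [exact: cg|exact: initial_continuous].
- by apply/funext => s; rewrite -[LHS]/(set_val ((g \o i) s)) gi.
- by move=> t; exact: set_valP (g t).
Qed.

(** The map [i] extends to a map of [bS] into the closure of the range of [i].
    Both this extension and the identity extend [i], so they coincide. *)
Lemma stone_cech_dense : dense (range i).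
Proof.
have cC : compact (closure (range i)).
  by apply: (subclosed_compact _ compact_setT) => //; exact: closed_closure.
have [g [cg gi Cg]] := stone_cech_extend_compact hausdorff_setT cC
  (fun s => @subset_closure _ (range i) _ (imageT i s)).
have [h [_ uh]] := sc.2 bS i sc.1.
have gid : g = id.
  by rewrite -(uh g (conj cg gi)); apply: uh; split => // x; exact: cvg_id.
move=> O [t Ot] oO.
have := Cg t; rewrite gid => /(_ O); rewrite setIC; apply.
by apply: open_nbhs_nbhs.
Qed.

Lemma nbhs_dense (t : bS) (U : set bS) : nbhs t U -> exists s, U (i s).
Proof.
rewrite nbhsE => -[V [oV Vt] VU].
have [y [Vs [s _ es]]] := stone_cech_dense (ex_intro _ t Vt) oV.
by exists s; apply: VU; rewrite es.
Qed.

(** The indicator of [s] extends to [g : bS -> bool]. A point [t] with [g t] is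
    a limit of points [i r] with [g (i r)], and [i s] is the only one. *)
Lemma clopen_stone_cech_pt s : clopen [set i s].
Proof.
have hbS := @hausdorff_setT bS.
have [g [[cg gi] _]] :=
  sc.2 bool (fun r => r == s) (@discrete_continuous _ _ _).
have gis r : g (i r) = (r == s) by rewrite -[LHS]/((g \o i) r) gi.
have gE t : g t -> t = i s.
  move=> gt; apply: hbS => A B At Bs.
  have gA : nbhs t (A `&` g @^-1` [set true]).
    by apply: filterI => //; apply: cg; rewrite gt; exact: discrete_set1.
  have [r [Ar]] := nbhs_dense gA; rewrite /= gis => /eqP rs.
  by exists (i r); split=> //; rewrite rs; exact: nbhs_singleton.
have -> : [set i s] = g @^-1` [set true].
  by apply/seteqP; split=> [_ ->|t /= /gE ->//]; rewrite /= gis eqxx.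
split.
  by move/continuousP: cg; apply; exact: discrete_open.
by apply: closed_comp => //; exact: discrete_closed.
Qed.

Lemma stone_cech_inj : injective i.
Proof.
move=> r s irs.
have [g [[cg gi] _]] :=
  sc.2 bool (fun r => r == s) (@discrete_continuous _ _ _).
have gis t : g (i t) = (t == s) by rewrite -[LHS]/((g \o i) t) gi.
by apply/eqP; rewrite -gis irs gis.
Qed.

End StoneCech.

(** * Unordered sums of scalars *)

Lemma normc_i (R : realType) : `|'i%C : R[i]%C| = 1.
Proof. by rewrite normc_def /= expr0n /= expr1n add0r sqrtr1. Qed.

Lemma normc_ge_Im (R : realType) (z : R[i]%C) :
  (`|complex.Im z|%:C)%C <= `|z|.
Proof.
have -> : complex.Im z = complex.Re (- 'i * z)%C.
  by case: z => a b; simpc.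
by rewrite (le_trans (normc_ge_Re _))// normrM normrN normc_i mul1r.
Qed.

(** The complex case is completeness of the real line applied to the real and
    imaginary parts, both of which are contractions. *)
Lemma scalar_complete (R : realType) (k : scalar_kind)
    (F : set_system (scalar_field R k)) :
  ProperFilter F -> cauchy F -> exists l : scalar_field R k, F --> l.
Proof.
case: k F => /= F FF; first by move=> /cauchy_cvg/cvg_ex.
move/cauchyP => cF.
have cvg_part (p : {additive R[i]%C -> R}) :
    (forall z, (`|p z|%:C)%C <= `|z|) -> cvg (p @ F).
  move=> p_le; apply: cauchy_cvg; apply/cauchy_exP => e e0.
  have [x Fx] := cF e%:C%C ltac:(by rewrite ltcR).
  exists (p x); apply: (@filterS _ F FF _ _ _ Fx) => y.
  rewrite -!ball_normE /= => xy.
  by rewrite -ltcR (le_lt_trans _ xy)// -raddfB; exact: p_le.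
have /cvg_ex[a Fa] := cvg_part (@complex.Re R) (@normc_ge_Re R).
have /cvg_ex[b Fb] := cvg_part (@complex.Im R) (@normc_ge_Im R).
exists (a +i* b)%C.
apply/(@cvgrPdist_lt _ (scalar_field R ComplexScalars : normedModType _)
  _ F FF id) => e.
rewrite ltcE /= => /andP[/eqP e_re e0].
have e2 : 0 < complex.Re e / 2 by rewrite divr_gt0.
have /cvgrPdist_lt/(_ _ e2) Na := Fa; have /cvgrPdist_lt/(_ _ e2) Nb := Fb.
apply: (@filterS2 _ F FF _ _ _ _ Na Nb) => y ya yb.
have -> : e = ((complex.Re e / 2)%:C + (complex.Re e / 2)%:C)%C.
  by rewrite -rmorphD -splitr; case: e e_re {e0 e2 Na Nb ya yb} => u v /= ->.
have -> : (a +i* b - y = (a - complex.Re y)%:C + 'i * (b - complex.Im y)%:C)%C.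
  by rewrite [y in LHS]complexE; simpc.
rewrite (le_lt_trans (ler_normD _ _))// ltrD //.
  by rewrite normc_def /= expr0n addr0 sqrtr_sqr ltcR.
rewrite normrM normc_i mul1r.
by rewrite normc_def /= expr0n addr0 sqrtr_sqr ltcR.
Qed.

#[local] Existing Instance totally_filter.

Lemma big_fset_subset (I : choiceType) (V : zmodType) (v : I -> V)
    (A B : {fset I}) : (A `<=` B)%fset ->
  \sum_(a <- B) v a = \sum_(a <- A) v a + \sum_(a <- (B `\` A)%fset) v a.
Proof.
move=> AB; rewrite (big_fsetID _ (mem A)) /=; congr (_ + _).
  apply: eq_fbigl => a; rewrite !inE /=.
  by case: (boolP (a \in A)) => [/(fsubsetP AB)->|]; rewrite ?andbF.
by apply: eq_fbigl => a; rewrite !inE /= andbC.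
Qed.

(** The finite sums of the [`|v a|] have a least upper bound [x]; once a
    finite set captures [x - e] of it, the rest contributes less than [e], so
    that the net of finite sums is Cauchy. *)
Lemma abs_summable_cvg (R : realType) (k : scalar_kind) (I : choiceType)
    (v : I -> scalar_field R k) (M : scalar_field R k) :
  (forall A : {fset I}, \sum_(a <- A) `|v a| <= M) ->
  exists l : scalar_field R k,
    (fun A : {fset I} => \sum_(a <- A) v a) @ totally --> l.
Proof.
move=> vM; pose u (A : {fset I}) := \sum_(a <- A) v a.
apply: scalar_complete; apply/cauchyP => e e0.
pose T (A : {fset I}) := \sum_(a <- A) `|v a|.
have T0 A : 0 <= T A by apply: sumr_ge0.
have [x [ubx lex]] : supremums (range T) !=set0.
  apply: scalar_supremums; first by exists (T fset0), fset0.
    by move=> _ [A _ <-].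
  by exists M => _ [A _ <-]; exact: vM.
have x0 : 0 <= x by rewrite (le_trans (T0 fset0))//; apply: ubx; exists fset0.
have xer : x - e \is Num.real by rewrite realB ?ger0_real// ltW.
have [A0 xA0] : exists A0, x - e < T A0.
  apply: contrapT => /forallNP xT.
  have : x <= x - e.
    apply: lex => _ [A _ <-]; rewrite real_leNgt ?(ger0_real (T0 A))//.
    by apply/negP; exact: xT.
  by rewrite lerDl oppr_ge0 => /(lt_le_trans e0); rewrite ltxx.
exists (u A0); exists A0 => // A /= A0A.
rewrite -ball_normE /= distrC /u (big_fset_subset _ A0A) addrAC subrr add0r.
rewrite (le_lt_trans (ler_norm_sum _ _ _))//.
rewrite -(ltrD2l (T A0)) -big_fset_subset// (@le_lt_trans _ _ x)//.
  by apply: ubx; exists A.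
by rewrite -ltrBlDr.
Qed.

(** * Functionals and continuous functions *)

Section Functionals.
Context (R : realType) (k : scalar_kind).
Local Notation K := (scalar_field R k).

Section Dual.
Context (Y : normedModType K).

Lemma dual_norm_ge (f : dual Y) y : `|f y| <= `|f| * `|y|.
Proof.
have [->|y0] := eqVneq y 0; first by rewrite linear0 !normr0 mulr0.
have y_gt0 : 0 < `|y| by rewrite normr_gt0.
have [M fM] := dual_bounded f.
have By : unit_ball Y (`|y|^-1 *: y).
  by rewrite /unit_ball /= normrZ normfV normr_id mulVf// normr_eq0.
have := sup_norm_ge fM By.
by rewrite linearZ normrZ normfV normr_id ler_pdivrMl// mulrC.
Qed.

Lemma dual_norm_le (f : dual Y) (M : K) : 0 <= M ->
  (forall y, `|y| <= 1 -> `|f y| <= M) -> `|f| <= M.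
Proof. by move=> M0 fM; apply: sup_norm_le. Qed.

Lemma bounded_linear_dual (f : Y -> K^o) (M : K) : linear f ->
  (forall y, `|f y| <= M * `|y|) -> exists F : dual Y, forall y, F y = f y.
Proof.
move=> lf fM.
pose lfM := GRing.isLinear.Build K Y K^o _ f lf.
pose fL : {linear Y -> K^o} := HB.pack f lfM.
have cf : continuous f.
  have /linear_bounded_continuous : bounded_near fL (nbhs 0); last exact.
  apply/bounded_funP => r; exists (`|M| * `|r|) => y yr.
  have r0 : 0 <= r by exact: le_trans yr.
  rewrite (le_trans (fM y))// (ger0_norm r0).
  rewrite (@le_trans _ _ (`|M * `|y| |))//.
    by rewrite ger0_norm// (le_trans _ (fM y)).
  by rewrite normrM normr_id ler_wpM2l.
have fP : f \in @dual_pred R k Y by apply/asboolP.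
by exists (Dual fP).
Qed.

Lemma weak_star_cvg (T : Type) (F : set_system T) (u : T -> dual Y)
    (Phi : dual Y) :
  Filter F -> (forall g, (u t g : K) @[t --> F] --> (Phi g : K)) ->
  u @ F --> (Phi : weak_star Y).
Proof.
move=> FF uPhi.
have : (fun t => (u t : Y -> K^o)) @ F --> (Phi : {ptws Y -> K^o}).
  apply/(@pointwise_cvgP Y K^o ((fun t => (u t : Y -> K^o)) @ F) Phi) => g.
  exact: uPhi.
move=> cu A [_ [[U oU <-] /= UPhi] UA].
have FU := cu U (open_nbhs_nbhs (conj oU UPhi)).
by apply: (@filterS _ F FF _ _ _ FU) => t /= Ut; exact: UA.
Qed.

(** The weak topology of the dual is tested by the elements of the bidual, so
    that at a point of continuity weak* limits in the unit ball are preserved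
    by every [G] in the bidual. *)
Lemma weak_star_weak_PC_cvg (T : Type) (F : set_system T)
    (u : T -> dual Y) (Phi : dual Y) (G : dual (dual Y)) :
  Filter F -> weak_star_weak_PC Phi -> (forall t, `|u t| <= 1) ->
  u @ F --> (Phi : weak_star Y) -> (G (u t) : K) @[t --> F] --> (G Phi : K).
Proof.
move=> FF [PhiB PC] uB uPhi W nW.
have nW' : nbhs (Phi : weak (dual Y)) [set f : dual Y | W (G f)].
  have c1 := @initial_continuous _ _
    ((fun y => fun f : dual (dual Y) => f y) :
      dual Y -> {ptws dual (dual Y) -> K^o}).
  have c2 := @proj_continuous (dual (dual Y)) (fun=> K^o) G.
  exact: (c1 Phi _ (c2 _ _ nW)).
have uS : u @ F --> (Phi : subspace (unit_ball (dual Y) : set (weak_star Y))).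
  apply/(@subspace_cvgP (weak_star Y) (unit_ball (dual Y)) (u @ F) Phi
    (fmap_filter u FF) PhiB) => V /uPhi.
  by rewrite nbhs_simpl /=; apply: (@filterS _ F FF) => t; apply; exact: uB.
exact: (uS _ (PC _ nW')).
Qed.

End Dual.

Section ContFun.
Context (T : compactHausdorffType) (X : normedModType K).
Implicit Types f g : contfun T X.

Lemma contfun_norm_ge f t : `|f t| <= `|f|.
Proof.
by have [M fM] := contfun_bounded f; exact: (@sup_norm_ge _ _ _ _ setT f M fM).
Qed.

Lemma contfun_norm_le f (M : K) : 0 <= M ->
  (forall t, `|f t| <= M) -> `|f| <= M.
Proof. by move=> M0 fM; apply: sup_norm_le. Qed.

Lemma continuous_contfun (f : T -> X) : continuous f ->
  exists F : contfun T X, F = f :> (T -> X).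
Proof.
move=> cf; have fP : f \in @contfun_pred R k T X by apply/asboolP.
by exists (ContFun fP).
Qed.

Lemma contfun_sumE (I : Type) (r : seq I) (F : I -> contfun T X) t :
  (\sum_(a <- r) F a) t = \sum_(a <- r) F a t.
Proof. by elim/big_rec2: _ => // a x y _ <-. Qed.

(** The value 0 is a default for discontinuous [h]. *)
Definition contfun_comp f (h : T -> T) : contfun T X := insubd 0 (f \o h).

Lemma contfun_compE f h : continuous h -> contfun_comp f h = f \o h :> (T -> X).
Proof.
move=> ch; rewrite /contfun_comp insubdK//; apply/asboolP => t.
by apply: continuous_comp; [exact: ch|exact: contfun_continuous].
Qed.

(** The value 0 is a default for sets [U] such that the truncated function is
    discontinuous. *)
Definition contfun_restrict (U : set T) f : contfun T X :=
  insubd 0 (fun t => if t \in U then f t else 0).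

Lemma contfun_restrictE (U : set T) f : clopen U ->
  contfun_restrict U f = (fun t => if t \in U then f t else 0) :> (T -> X).
Proof.
move=> [oU cU]; rewrite /contfun_restrict insubdK//; apply/asboolP.
set fU := (X in continuous X) => t.
have [Ut|Ut] := pselect (U t).
  have nU : nbhs t U by apply: open_nbhs_nbhs.
  have Ef : {near nbhs t, f =1 fU}.
    by apply: filterS nU => x Ux; rewrite /fU mem_set.
  have Et : fU t = f t by rewrite /fU mem_set.
  rewrite /continuous_at Et.
  by apply: cvg_trans (near_eq_cvg Ef) (@contfun_continuous _ _ _ _ f t).
have nU : nbhs t (~` U).
  by apply: open_nbhs_nbhs; split; [rewrite openC|exact: Ut].
have Ef : {near nbhs t, (fun=> 0) =1 fU}.
  by apply: filterS nU => x Ux; rewrite /fU memNset.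
have Et : fU t = 0 by rewrite /fU memNset.
rewrite /continuous_at Et; apply: cvg_trans (near_eq_cvg Ef) (cvg_cst _).
Qed.

End ContFun.

End Functionals.

(** * The part of a functional carried by the discrete set *)

Section Atoms.
Context (R : realType) (k : scalar_kind).
Local Notation K := (scalar_field R k).
Context (S : discreteTopologicalType) (bS : compactHausdorffType) (i : S -> bS).
Context (X : normedModType K).
Hypothesis sc : stone_cech i.
Local Notation Y := (contfun bS X).
Implicit Types (g : Y) (Psi : dual Y).

Definition atom s g : Y := contfun_restrict [set i s] g.

Lemma atomE s g r : atom s g (i r) = if r == s then g (i r) else 0.
Proof.
rewrite /atom (contfun_restrictE _ (clopen_stone_cech_pt sc s)).
rewrite (_ : (i r \in [set i s]) = (r == s))//.
by apply/idP/eqP => [|->]; rewrite in_setE//= => /(stone_cech_inj sc).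
Qed.

Lemma stone_cech_norm_le g (M : K) : (forall s, `|g (i s)| <= M) ->
  forall t, `|g t| <= M.
Proof.
move=> gM t; apply/ler_addgt0Pr => e e0.
have /(nbhs_dense sc)[s gs] : nbhs t [set x | `|g t - g x| <= e].
  apply: (@cvgr_dist_le _ _ _ (nbhs t) _ g (g t)) => //.
  exact: contfun_continuous.
rewrite -[g t](subrK (g (i s))) addrC (le_trans (ler_normD _ _))//.
by rewrite lerD.
Qed.

(** Different atoms have disjoint supports. *)
Lemma atoms_norm_le (A : {fset S}) (c : S -> K) g : (forall s, `|c s| <= 1) ->
  `|\sum_(s <- A) c s *: atom s g| <= `|g|.
Proof.
move=> c1; apply: contfun_norm_le => //; apply: stone_cech_norm_le => r.
rewrite contfun_sumE.
have E s : (c s *: atom s g) (i r) = if s == r then c r *: g (i r) else 0.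
  rewrite -[LHS]/(c s *: atom s g (i r)) atomE [s == r]eq_sym.
  by case: eqP => [->|_]; rewrite ?scaler0.
under eq_bigr do rewrite E.
have [rA|rA] := boolP (r \in A).
  rewrite (big_fsetD1 r)//= eqxx big1_fset ?addr0.
    rewrite normrZ (le_trans _ (contfun_norm_ge g (i r)))//.
    by rewrite ler_piMl.
  by move=> s; rewrite !inE => /andP[/negbTE->].
rewrite big1_fset ?normr0// => s sA _; case: eqP => // sr.
by rewrite -sr sA in rA.
Qed.

(** Multiplying each atom by a phase that makes its image under [Psi]
    nonnegative turns the left-hand side into one value of [Psi], at a function
    of norm at most [`|g|]. *)
Lemma atoms_abs_sum_le (A : {fset S}) Psi g :
  \sum_(s <- A) `|Psi (atom s g)| <= `|Psi| * `|g|.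
Proof.
pose c s : K := `|Psi (atom s g)| / Psi (atom s g).
have c1 s : `|c s| <= 1.
  rewrite /c; move: (Psi _ : K) => z.
  rewrite normrM normfV normr_id; have [->|z0] := eqVneq z 0.
    by rewrite normr0 mul0r ler01.
  by rewrite mulfV// normr_eq0.
have cE s : c s * Psi (atom s g) = `|Psi (atom s g)|.
  rewrite /c; move: (Psi _ : K) => z.
  have [->|z0] := eqVneq z 0; first by rewrite mulr0 normr0.
  by rewrite divfK.
have PsiE : Psi (\sum_(s <- A) c s *: atom s g) =
    \sum_(s <- A) `|Psi (atom s g)|.
  rewrite linear_sum; apply: eq_bigr => s _; rewrite linearZ; exact: cE.
rewrite -PsiE -[leLHS]ger0_norm ?PsiE ?sumr_ge0// -PsiE.
rewrite (le_trans (dual_norm_ge _ _))// ler_wpM2l//.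
exact: atoms_norm_le.
Qed.

(** This bidual element measures how far [Psi] is from being concentrated on
    [S]. It vanishes at finite combinations of point functionals at [S], which
    are weak* dense. *)
Lemma atomic_defect g : exists F : dual (dual Y), forall Psi (l : K),
  (fun A : {fset S} => \sum_(s <- A) (Psi (atom s g) : K)) @ totally --> l ->
  F Psi = Psi g - l :> K.
Proof.
have L_ex Psi := abs_summable_cvg (fun A => atoms_abs_sum_le A Psi g).
have [L LP] := choice L_ex.
have L_uniq Psi (u : {fset S} -> K) (l : K) :
    (forall A, u A = \sum_(s <- A) (Psi (atom s g) : K)) ->
    u @ totally --> l -> L Psi = l.
  move=> /funext -> Psil.
  exact: (cvg_unique (@norm_hausdorff K K) (LP Psi) Psil).
have L_lin a Psi Psi' : L (a *: Psi + Psi') = a * L Psi + L Psi'.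
  apply: (L_uniq _ (fun A : {fset S} =>
    a * (\sum_(s <- A) (Psi (atom s g) : K)) +
    \sum_(s <- A) (Psi' (atom s g) : K))).
    by move=> A; rewrite mulr_sumr -big_split.
  by apply: cvgD; [apply: cvgMr|]; exact: LP.
have L_le Psi : `|L Psi| <= `|g| * `|Psi|.
  apply/ler_addgt0Pr => e e0.
  have /cvgrPdist_le/(_ _ e0)[A _ /(_ A (fsubset_refl A))] := LP Psi.
  set u := \sum_(_ <- _) _ => /= Lu.
  rewrite -[L Psi](subrK u) addrC (le_trans (ler_normD _ _))// lerD//.
  rewrite mulrC (le_trans _ (atoms_abs_sum_le A Psi g))//.
  exact: ler_norm_sum.
pose F0 Psi : K^o := Psi g - L Psi.
have [] := @bounded_linear_dual _ _ (dual Y) F0 (`|g| + `|g|).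
- move=> a Psi Psi'; rewrite /F0 L_lin.
  rewrite -[X in X - _]/(a * Psi g + Psi' g) -[RHS]/(a * (_ - _) + (_ - _)).
  by rewrite mulrBr opprD addrACA.
- move=> Psi; rewrite /F0 (le_trans (ler_normB _ _))// mulrDl lerD//.
  by rewrite mulrC dual_norm_ge.
by move=> F FE; exists F => Psi l Psil; rewrite FE /F0 (L_uniq _ _ _ _ Psil).
Qed.

End Atoms.

(** * Approximating the identity by maps with finite range *)

Section FiniteRange.
Context (S : discreteTopologicalType) (bS : compactHausdorffType) (i : S -> bS).
Hypothesis sc : stone_cech i.

Definition finite_range (sigma : S -> S) : Prop :=
  exists A : {fset S}, forall s, sigma s \in A.

(** The neighborhoods of the diagonal form the uniformity of the compact
    space [bS]. *)
Definition uniformly_near_id : set_system (S -> S) :=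
  filter_from [set G : set (bS * bS) | forall t : bS, nbhs (t, t) G]
    (fun G => [set sigma | finite_range sigma /\
                           forall s, G (i s, i (sigma s))]).

(** By compactness and density, finitely many points of [S] suffice to be close
    to each point of [bS]; [sigma] then picks one of them close to [s]. *)
Lemma uniformly_near_id_proper : ProperFilter uniformly_near_id.
Proof.
apply: filter_from_proper.
  apply: filter_from_filter; first by exists setT => t /=; exact: filterT.
  move=> G H nG nH; exists (G `&` H); first by move=> t; exact: filterI.
  by move=> sigma [fs GHs]; split; split => // s; have [] := GHs s.
move=> G nG /=.
have /compact_near_coveringP cS := @compact_setT bS.
have : \forall A \near (totally : set_system {fset S}),
    [set: bS] `<=` [set t | exists2 r, r \in A & G (t, i r)].
  apply: cS => t _.
  have [[U V] /= [nU nV] UVG] := nG t.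
  have [r Vr] := nbhs_dense sc nV.
  exists (U, [set A : {fset S} | ([fset r] `<=` A)%fset]) => /=.
    by split => //; exists [fset r]%fset.
  move=> [t' A] /= [Ut' rA]; exists r; last by apply: UVG.
  by apply: (fsubsetP rA); rewrite !inE.
move=> /(@filter_ex _ _ (@totally_filter S))[A GA].
have /choice[sigma sigmaP] : forall s, exists r, r \in A /\ G (i s, i r).
  by move=> s; have [r] := GA (i s) I; exists r.
exists sigma; split; first by exists A => s; have [] := sigmaP s.
by move=> s; have [] := sigmaP s.
Qed.
#[local] Existing Instance uniformly_near_id_proper.

Context (R : realType) (k : scalar_kind).
Local Notation K := (scalar_field R k).
Context (X : normedModType K).
Local Notation Y := (contfun bS X).
Implicit Types (g : Y) (Phi Psi : dual Y).

Lemma dual_comp (h : bS -> bS) Phi : continuous h ->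
  exists Psi : dual Y, `|Psi| <= `|Phi| /\
    forall g, Psi g = Phi (contfun_comp g h) :> K.
Proof.
move=> ch; pose F g : K^o := Phi (contfun_comp g h).
have F_le g : `|F g| <= `|Phi| * `|g|.
  rewrite /F (le_trans (dual_norm_ge _ _))// ler_wpM2l//.
  apply: contfun_norm_le => // t; rewrite contfun_compE//.
  exact: contfun_norm_ge.
have [|Psi PsiE] := bounded_linear_dual _ F_le.
  move=> a f g; rewrite /F.
  have -> : contfun_comp (a *: f + g) h =
      a *: contfun_comp f h + contfun_comp g h.
    apply/val_inj/funext => t; rewrite -[LHS]/(contfun_comp (a *: f + g) h t).
    rewrite -[RHS]/(a *: contfun_comp f h t + contfun_comp g h t).
    by rewrite !contfun_compE.
  exact: linearP.
exists Psi; split=> //; apply: dual_norm_le => // g g1.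
by rewrite PsiE (le_trans (F_le g))// ler_piMr.
Qed.

Lemma contfun_comp_near_id (h : (S -> S) -> bS -> bS) g (e : K) :
  (forall sigma, continuous (h sigma) /\ h sigma \o i = i \o sigma) -> 0 < e ->
  \forall sigma \near uniformly_near_id, `|g - contfun_comp g (h sigma)| <= e.
Proof.
move=> hP e0.
exists [set tt : bS * bS | `|g tt.1 - g tt.2| <= e].
  move=> t /=.
  have e2 : 0 < e / 2 by rewrite divr_gt0.
  have gt : nbhs t [set x | `|g t - g x| <= e / 2].
    apply: (@cvgr_dist_le _ _ _ (nbhs t) _ g (g t)) => //.
    exact: contfun_continuous.
  exists ([set x | `|g t - g x| <= e / 2], [set x | `|g t - g x| <= e / 2]).
    by split.
  move=> [x y] /= [gx gy].
  rewrite -(subrKA (g t)) [e]splitr (le_trans (ler_normD _ _))//.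
  by rewrite lerD// distrC.
move=> sigma [_ gs]; have [ch hi] := hP sigma.
apply: contfun_norm_le; first exact: ltW.
apply: (stone_cech_norm_le sc) => s.
rewrite -[X in `|X|]/(g (i s) - contfun_comp g (h sigma) (i s)).
by rewrite contfun_compE// /= -[h _ _]/((h sigma \o i) s) hi; exact: gs.
Qed.

Lemma contfun_eq_dense (f g : Y) : (forall s, f (i s) = g (i s)) -> f = g.
Proof.
move=> fg; apply/eqP; rewrite -subr_eq0 -normr_le0.
apply: contfun_norm_le => //; apply: (stone_cech_norm_le sc) => s.
by rewrite -[X in `|X|]/(f (i s) - g (i s)) fg subrr normr0.
Qed.

Lemma atoms_sumE (A : {fset S}) g r : r \in A ->
  (\sum_(s <- A) atom i s g) (i r) = g (i r).
Proof.
move=> rA; rewrite contfun_sumE (big_fsetD1 r)//= atomE// eqxx.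
rewrite big1_fset ?addr0//.
by move=> s; rewrite !inE atomE// [r == s]eq_sym => /andP[/negbTE->].
Qed.

(** Both sides agree on the dense set [S], where [h] only takes values in the
    finite set [A]. *)
Lemma atoms_sum_comp sigma (h : bS -> bS) (A : {fset S}) g :
  continuous h -> h \o i = i \o sigma -> (forall s, sigma s \in A) ->
  contfun_comp (\sum_(s <- A) atom i s g) h = contfun_comp g h.
Proof.
move=> ch hi sA; apply: contfun_eq_dense => s; rewrite !contfun_compE//=.
by rewrite -[h _]/((h \o i) s) hi /= atoms_sumE.
Qed.

End FiniteRange.

(** * Points of continuity are concentrated on the discrete set *)

Section PointOfContinuity.
Context (S : discreteTopologicalType) (bS : compactHausdorffType) (i : S -> bS).
Hypothesis sc : stone_cech i.
Context (R : realType) (k : scalar_kind).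
Local Notation K := (scalar_field R k).
Context (X : normedModType K).
Local Notation Y := (contfun bS X).

(** The functionals [u sigma] tend weak* to [Phi] and annihilate the bidual
    element [F] of [atomic_defect]; so does [Phi], by continuity. *)
Lemma weak_star_weak_PC_sum_atoms (Phi : dual Y) : weak_star_weak_PC Phi ->
  forall g, (fun A : {fset S} => \sum_(s <- A) (Phi (atom i s g) : K))
    @ totally --> (Phi g : K).
Proof.
move=> PC g.
have FF := uniformly_near_id_proper sc.
have /choice[h hP] : forall sigma : S -> S, exists e : bS -> bS,
    continuous e /\ e \o i = i \o sigma.
  move=> sigma.
  have [e [[ce ei] _]] := sc.2 bS (i \o sigma) (@discrete_continuous _ _ _).
  by exists e.
have /choice[u uP] : forall sigma, exists Psi : dual Y, `|Psi| <= `|Phi| /\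
    forall f, Psi f = Phi (contfun_comp f (h sigma)) :> K.
  by move=> sigma; apply: dual_comp; have [] := hP sigma.
have uPhi : u @ uniformly_near_id i --> (Phi : weak_star Y).
  apply: weak_star_cvg => f; apply/cvgrPdist_le => e e0.
  have P1 : 0 < `|Phi| + 1 by rewrite ltr_wpDl.
  have d0 : 0 < e / (`|Phi| + 1) by rewrite divr_gt0.
  apply: filterS (contfun_comp_near_id sc f hP d0) => sigma fe.
  rewrite (uP sigma).2 -[X in `|X|]/(_ - _ : K^o) -linearB.
  rewrite (le_trans (dual_norm_ge _ _))// (le_trans (ler_wpM2l _ fe))//.
  by rewrite mulrA ler_pdivrMr// mulrC ler_wpM2l ?lerDl// ltW.
have [F FP] := atomic_defect sc g.
have [l Phil] := abs_summable_cvg (fun A => atoms_abs_sum_le sc A Phi g).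
have u1 sigma : `|u sigma| <= 1.
  by rewrite (le_trans (uP sigma).1)//; case: PC.
have Fu := weak_star_weak_PC_cvg (G := F) (@filter_filter _ _ FF) PC u1 uPhi.
have F0 : (F (u t) : K) @[t --> uniformly_near_id i] --> (0 : K).
  suff nF0 : {near uniformly_near_id i,
      (fun=> 0 : K) =1 (fun t => F (u t) : K)}.
    exact: cvg_trans (near_eq_cvg nF0) (cvg_cst _).
  (* every sigma with finite range will do, however far from the identity *)
  exists setT; first by move=> t /=; exact: filterT.
  move=> sigma [[A sA] _] /=; have [ch hi] := hP sigma.
  rewrite (FP _ (u sigma g)) ?subrr//.
  suff nu : {near (totally : set_system {fset S}), (fun=> u sigma g : K) =1
      (fun B : {fset S} => \sum_(s <- B) (u sigma (atom i s g) : K))}.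
    exact: cvg_trans (near_eq_cvg nu) (cvg_cst _).
  exists A => // B /= AB.
  rewrite -(linear_sum (u sigma)) -[RHS]/(u sigma _) !(uP sigma).2.
  by rewrite (atoms_sum_comp sc _ ch hi)// => s; exact: (fsubsetP AB).
have FPhi0 : F Phi = 0 :> K.
  exact: (cvg_unique (@norm_hausdorff K K) Fu F0).
move: FPhi0; rewrite (FP _ _ Phil) => Phig.
by rewrite (subr0_eq Phig).
Qed.

End PointOfContinuity.

(** * Norm attainment *)

Section NormAttainment.
Context (S : discreteTopologicalType) (bS : compactHausdorffType) (i : S -> bS).
Hypothesis sc : stone_cech i.
Context (R : realType) (k : scalar_kind).
Local Notation K := (scalar_field R k).
Context (X : normedModType K).
Local Notation Y := (contfun bS X).
Implicit Types (g f : Y) (Phi : dual Y) (mu : set bS -> dual X).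

Lemma borel_stone_cech_pt s : borel bS [set i s].
Proof.
have [oi _] := clopen_stone_cech_pt sc s.
by move=> B [_]; apply.
Qed.

(** An atom is a simple function: the partition of [bS] into the point [i s]
    and its complement computes its integral exactly. *)
Lemma represents_atom mu Phi s g : represents mu Phi ->
  Phi (atom i s g) = mu [set i s] (g (i s)) :> K.
Proof.
move=> [_ /(_ (atom i s g)) int].
have [oi ci] := clopen_stone_cech_pt sc s.
apply/eqP; rewrite -subr_eq0 -normr_le0; apply/ler_addgt0Pr => e e0.
rewrite add0r; have [d d0] := int e e0.
pose P (j : 'I_2) : set bS := if j == 0 then [set i s] else ~` [set i s].
pose x (j : 'I_2) := if j == 0 then g (i s) else 0.
move=> /(_ 2%N P x); rewrite big_ord_recl big_ord1 /P /x /= linear0 addr0.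
apply.
  split.
  - move=> j B [_ oB]; apply: oB; case: ifP => _ //.
    exact: closed_openC.
  - move=> [[|[|//]] pa] [[|[|//]] pb] _ _ [t [/= ta tb]];
      by [exact: val_inj|case: (ta tb)|case: (tb ta)].
  - apply/seteqP; split => // t _; have [->|ti] := eqVneq t (i s).
      by exists 0.
    by exists 1 => //=; apply/eqP.
move=> j t; rewrite /atom contfun_restrictE//.
case: ifP => _ /= tP.
  by rewrite tP mem_set// subrr normr0 ltW.
by rewrite memNset// subrr normr0 ltW.
Qed.

(** Each atom of [f] dominates the corresponding atom of [g] under [Phi]; the
    finite sums are compared up to [e], which spares the closedness of the
    partial order of the complex numbers. *)
Lemma norming_of_atoms mu Phi f : represents mu Phi ->
  (forall g, (fun A : {fset S} => \sum_(s <- A) (Phi (atom i s g) : K))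
     @ totally --> (Phi g : K)) ->
  (forall s, mu [set i s] (f (i s)) = `|mu [set i s]| :> K) ->
  `|Phi| <= `|Phi f|.
Proof.
move=> mu_Phi Phi_sum fmu; apply: dual_norm_le => // g g1.
apply/ler_addgt0Pr => e e0; have e2 : 0 < e / 2 by rewrite divr_gt0.
have /cvgrPdist_le/(_ _ e2) Ng := Phi_sum g.
have /cvgrPdist_le/(_ _ e2) Nf := Phi_sum f.
have [A /= [gA fA]] := @filter_ex _ _ (@totally_filter S) _ (filterI Ng Nf).
have le_gf : `|\sum_(s <- A) (Phi (atom i s g) : K)| <=
    `|\sum_(s <- A) (Phi (atom i s f) : K)|.
  have -> : \sum_(s <- A) (Phi (atom i s f) : K) =
      \sum_(s <- A) `|mu [set i s]|.
    by apply: eq_bigr => s _; rewrite (represents_atom _ _ mu_Phi) fmu.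
  rewrite [leRHS]ger0_norm ?sumr_ge0// (le_trans (ler_norm_sum _ _ _))//.
  apply: ler_sum => s _; rewrite (represents_atom _ _ mu_Phi).
  rewrite (le_trans (dual_norm_ge _ _))// ler_piMr//.
  exact: le_trans (contfun_norm_ge g _) g1.
have le_g : `|Phi g| <= `|\sum_(s <- A) (Phi (atom i s g) : K)| + e / 2.
  by rewrite -lerBlDl (le_trans (lerB_dist _ _)).
have le_f : `|\sum_(s <- A) (Phi (atom i s f) : K)| <= `|Phi f| + e / 2.
  by rewrite -lerBlDl (le_trans (lerB_dist _ _))// distrC.
rewrite (le_trans le_g)// [in leRHS](splitr e) addrA lerD2r.
exact: le_trans le_gf le_f.
Qed.

End NormAttainment.

(** For nonzero [Phi] the inequality forces [`|f| = 1], and it remains to rotate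
    [f] by a phase; the zero functional attains its norm anywhere, provided the
    sphere is nonempty. *)
Lemma attains_norm_sphere (R : realType) (k : scalar_kind)
    (Y : normedModType (scalar_field R k)) (Phi : dual Y) (f : Y) :
  (exists y : Y, y != 0) -> `|f| <= 1 -> `|Phi| <= `|Phi f| ->
  attains_norm Phi (unit_sphere Y).
Proof.
move=> [y y0] f1 Phif; have [P0|P0] := eqVneq Phi 0.
  exists (`|y|^-1 *: y); last by rewrite P0 normr0.
  by rewrite /unit_sphere /= normrZ normfV normr_id mulVf// normr_eq0.
have P_gt0 : 0 < `|Phi| by rewrite normr_gt0.
have fE : `|f| = 1.
  apply/eqP; rewrite eq_le f1 -(ler_pM2l P_gt0) mulr1.
  exact: le_trans Phif (dual_norm_ge Phi f).
have PE : `|Phi f| = `|Phi|.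
  apply/eqP; rewrite eq_le Phif andbT.
  by rewrite -[leRHS]mulr1 -fE dual_norm_ge.
have Pf0 : (Phi f : scalar_field R k) != 0 by rewrite -normr_eq0 PE gt_eqF.
exists ((`|Phi| / Phi f) *: f).
  rewrite /unit_sphere /= normrZ fE mulr1 normrM normfV PE normr_id.
  by rewrite mulfV// gt_eqF.
rewrite linearZ -[LHS]/(_ * _ : scalar_field R k); exact: divfK.
Qed.

Theorem theorem3p10 (R : realType) (k : scalar_kind)
    (S : discreteTopologicalType) (bS : compactHausdorffType) (i : S -> bS)
    (X : completeNormedModType (scalar_field R k))
    (Phi : dual (contfun bS X)) (mu : set bS -> dual X) :
  infinite_set [set: S] ->
  stone_cech i ->
  (exists x : X, x != 0) ->
  represents mu Phi ->
  weak_star_weak_PC Phi ->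
  (exists x : nat -> X,
    [/\ range x `<=` unit_ball X,
        forall B, borel bS B -> attains_norm (mu B) (range x) &
        compact (closure (range x))]) ->
  attains_norm Phi (unit_sphere (contfun bS X)).
Proof.
move=> S_inf sc [x0 x0_neq0] mu_Phi PC [x [x_ball mu_att x_compact]].
have /choice[v vP] : forall s, exists v, range x v /\
    mu [set i s] v = `|mu [set i s]| :> scalar_field R k.
  move=> s; have [v xv mu_v] := mu_att _ (borel_stone_cech_pt sc s).
  by exists v.
have [f [cf fi _]] := stone_cech_extend_compact sc (@norm_hausdorff _ X)
  x_compact (fun s => subset_closure (vP s).1).
have [F FE] := @continuous_contfun R k bS X f cf.
have Fi s : F (i s) = v s by rewrite FE -[LHS]/((f \o i) s) fi.
apply: (attains_norm_sphere (f := F)).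
- have [c cE] := @continuous_contfun R k bS X (fun=> x0) (fun _ => cvg_cst _).
  have [s _] := infinite_setN0 S_inf.
  exists c; apply: contra_neq x0_neq0 => c0.
  by rewrite -[x0]/((fun=> x0) (i s)) -cE c0.
- apply: contfun_norm_le => //; apply: (stone_cech_norm_le sc) => s.
  by rewrite Fi; apply: x_ball; case: (vP s).
- apply: (norming_of_atoms sc mu_Phi); first exact: weak_star_weak_PC_sum_atoms.
  by move=> s; rewrite Fi; case: (vP s).
Qed.
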